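(* Let $n\in\{1,2,3,\dots\}$, let $A\in\mathbb{R}^{n\times n}$ be a symmetric and positive definite matrix and let $C\in\mathbb{R}^{n\times n\times n\times n}$ be arbitrary. Then there exist symmetric and positive semi-definite tensors $E\in\mathbb{R}^{n\times n}$ and $F\in\mathbb{R}^{n\times n\times n\times n}$ such that the differential operator $CD^4$ can be written as $$-CD^4=ED^2AD^2-FD^4 .$$
   Context: Differential operators on $\mathbb{R}^n$ with constant coefficients: $AD^2=\sum_{i,j}A_{ij}\partial_i\partial_j$, $ED^2=\sum_{i,j}E_{ij}\partial_i\partial_j$, $CD^4=\sum_{i,j,k,l}C_{ijkl}\partial_i\partial_j\partial_k\partial_l$, $FD^4=\sum_{i,j,k,l}F_{ijkl}\partial_i\partial_j\partial_k\partial_l$; $ED^2AD^2$ is the composition of $ED^2$ with $AD^2$. Symmetric and positive semi-definite means: $E_{ij}=E_{ji}$ for all $i,j$ and $\sum_{i,j}E_{ij}\eta_i\eta_j\ge0$ for every $\eta\in\mathbb{R}^n$; $F_{ijkl}=F_{klij}$ for all $i,j,k,l$ and $\sum_{i,j,k,l}F_{ijkl}\xi_{ij}\xi_{kl}\ge0$ for every $\xi\in\mathbb{R}^{n\times n}$. *)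

(* Defs.v *)
From HB Require Import structures.
From mathcomp Require Import all_boot all_order all_algebra.
From mathcomp Require Import all_classical all_reals all_analysis.

Set Implicit Arguments.
Unset Strict Implicit.
Unset Printing Implicit Defensive.

Import Order.TTheory GRing.Theory Num.Theory.
Import numFieldNormedType.Exports.

Local Open Scope classical_set_scope.
Local Open Scope ring_scope.

Definition tensor4 (R : realType) (n : nat) : Type :=
  'I_n -> 'I_n -> 'I_n -> 'I_n -> R.

Definition symmetric2 (R : realType) (n : nat) (E : 'M[R]_n) : Prop :=
  forall i j, E i j = E j i.

Definition pos_def2 (R : realType) (n : nat) (A : 'M[R]_n) : Prop :=
  forall eta : 'rV[R]_n, eta != 0 ->
    0 < \sum_i \sum_j A i j * eta 0 i * eta 0 j.

Definition pos_semidef2 (R : realType) (n : nat) (E : 'M[R]_n) : Prop :=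
  forall eta : 'rV[R]_n, 0 <= \sum_i \sum_j E i j * eta 0 i * eta 0 j.

(* Only the exchange of the two index pairs is required (no symmetry within a
   pair), and nonnegativity is tested on all matrices, symmetric or not. *)
Definition symmetric4 (R : realType) (n : nat) (F : tensor4 R n) : Prop :=
  forall i j k l, F i j k l = F k l i j.

Definition pos_semidef4 (R : realType) (n : nat) (F : tensor4 R n) : Prop :=
  forall xi : 'M[R]_n,
    0 <= \sum_i \sum_j \sum_k \sum_l F i j k l * xi i j * xi k l.

Definition partial (R : realType) (n : nat) (i : 'I_n) (u : 'rV[R]_n -> R) :
    'rV[R]_n -> R :=
  fun x => 'D_(delta_mx 0 i) u x.

(* Functions of class C^k on R^n. The derivability clause is needed because
   ['D_v u x] is a total operator, with a junk value where the directional
   derivative does not exist. *)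
Fixpoint class_C (R : realType) (n k : nat) (u : 'rV[R]_n -> R) : Prop :=
  continuous u /\
  if k is k'.+1 then
    forall i : 'I_n,
      (forall x, derivable u x (delta_mx 0 i)) /\ class_C k' (partial i u)
  else True.

Definition opD2 (R : realType) (n : nat) (A : 'M[R]_n) (u : 'rV[R]_n -> R) :
    'rV[R]_n -> R :=
  fun x => \sum_i \sum_j A i j * partial i (partial j u) x.

Definition opD4 (R : realType) (n : nat) (C : tensor4 R n)
    (u : 'rV[R]_n -> R) : 'rV[R]_n -> R :=
  fun x => \sum_i \sum_j \sum_k \sum_l
    C i j k l * partial i (partial j (partial k (partial l u))) x.

(* Main.v *)
(** The symbol of [C D^4] does not change when the entries of [C] are permuted
    among the orderings of the four indices (Schwarz's theorem), so
    [E D^2 A D^2] with [E = t 1] is also [T D^4] for the rearranged tensor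
    [T_ijkl = t delta_ik A_jl].  As a quadratic form on matrices, [T] maps [xi]
    to [t] times the sum of the values of [A] on the rows of [xi], hence is
    positive definite, and for [t] large it dominates the pair-symmetrization
    of [C]; take [F] to be the sum of the two. *)
Require Import Defs.
From HB Require Import structures.
From mathcomp Require Import all_boot all_order all_algebra.
From mathcomp Require Import all_classical all_reals all_analysis.
From mathcomp Require Import ring lra.

Set Implicit Arguments.
Unset Strict Implicit.
Unset Printing Implicit Defensive.

Import Order.TTheory GRing.Theory Num.Theory.
Import numFieldNormedType.Exports.

Local Open Scope ring_scope.

(** * Schwarz's theorem on mixed directional derivatives *)

Lemma is_derive_line (R : realType) (V W : normedModType R) (f : V -> W)
    (v y : V) (s : R) : derivable f (s *: v + y) v ->
  is_derive s 1 (fun r : R => f (r *: v + y)) ('D_v f (s *: v + y)).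
Proof.
move=> df.
(* The two difference quotients are the same function of [h], so existence and value of the
   derivative transfer together. *)
have quotE : (fun h : R => h^-1 *: (((fun r : R => f (r *: v + y)) \o shift s)
      (h *: 1) - f (s *: v + y))) =
    (fun h : R => h^-1 *: ((f \o shift (s *: v + y)) (h *: v)
      - f (s *: v + y))).
  by apply/funext => h /=; rewrite [h *: 1]mulr1 scalerDl addrA.
by split; rewrite /derivable /derive quotE.
Qed.

Lemma MVT_line (R : realType) (f df : R -> R) (h : R) : 0 < h ->
  (forall s : R, is_derive s 1 f (df s)) ->
  exists2 c, 0 < c < h & f h - f 0 = df c * h.
Proof.
move=> h0 fdf.
have cf : continuous f.
  move=> s; apply/differentiable_continuous/derivable1_diffP.
  by case: (fdf s).
have [c + fE] := MVT h0 (fun s _ => fdf s) (continuous_subspaceT cf).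
by rewrite in_itv /= => c0h; exists c => //; rewrite fE subr0.
Qed.

(** The mean value theorem is used twice: along [v] for the difference of [f] on two parallel
    segments, then along [w] for ['D_v f]. The left-hand side is symmetric in [v] and [w], whereas
    the right-hand side records the order of differentiation. *)
Lemma second_difference (R : realType) (V : normedModType R) (f : V -> R)
    (v w x : V) (h : R) : 0 < h ->
  (forall y, derivable f y v) -> (forall y, derivable ('D_v f) y w) ->
  exists c d, [/\ 0 < c < h, 0 < d < h &
    f (h *: v + (h *: w + x)) - f (h *: v + x) - f (h *: w + x) + f x =
    'D_w ('D_v f) (d *: w + (c *: v + x)) * h * h].
Proof.
move=> h0 dvf dwvf.
have [s|c c0h fE] := @MVT_line R
    (fun s => f (s *: v + (h *: w + x)) - f (s *: v + x))
    (fun s => 'D_v f (s *: v + (h *: w + x)) - 'D_v f (s *: v + x)) h h0.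
  by apply: is_deriveB; exact: is_derive_line.
have [s|d d0h gE] := @MVT_line R (fun s => 'D_v f (s *: w + (c *: v + x)))
    (fun s => 'D_w ('D_v f) (s *: w + (c *: v + x))) h h0.
  exact: is_derive_line.
exists c, d; split => //.
rewrite -gE scale0r add0r [h *: w + (c *: v + x)]addrCA -fE !scale0r !add0r.
ring.
Qed.

(** Near [x], both [g x] and [k x] are within [e / 2] of a common value, for every [e > 0]. *)
Lemma eq_of_common_values (R : realType) (V : normedModType R) (g k : V -> R)
    (x : V) :
  {for x, continuous g} -> {for x, continuous k} ->
  (forall r : R, 0 < r ->
    exists y z, [/\ `|x - y| < r, `|x - z| < r & g y = k z]) ->
  g x = k x.
Proof.
move=> cg ck common; apply/eqP; rewrite -subr_eq0 -normr_le0.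
apply/ler_addgt0Pr => e e0; rewrite add0r.
have e20 : 0 < e / 2 by rewrite divr_gt0.
have Ng := cvgr_dist_lt (FF := nbhs_filter x) _ _ cg _ e20.
have Nk := cvgr_dist_lt (FF := nbhs_filter x) _ _ ck _ e20.
have [r /= r0 near_x] := (nbhs_normP x _).1 (filterI Ng Nk).
have [y [z [xy xz gk]]] := common r r0.
have [+ _] := near_x _ xy; have [_ +] := near_x _ xz.
rewrite gk => ltk ltg; rewrite [leRHS](splitr e).
apply: le_trans (ler_distD (k z) _ _) _.
by rewrite [X in _ + X]distrC lerD ?ltW.
Qed.

Lemma derive_swap (R : realType) (V : normedModType R) (f : V -> R)
    (v w x : V) :
  (forall y, derivable f y v) -> (forall y, derivable f y w) ->
  (forall y, derivable ('D_v f) y w) -> (forall y, derivable ('D_w f) y v) ->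
  {for x, continuous ('D_w ('D_v f))} -> {for x, continuous ('D_v ('D_w f))} ->
  'D_w ('D_v f) x = 'D_v ('D_w f) x.
Proof.
move=> dv dw dwv dvw cwv cvw; apply: (eq_of_common_values cwv cvw) => r r0.
(* The intermediate points differ from [x] by less than [h] times each direction, hence by at most
   [h * (m - 1) < h * m = r]. The summand 1 keeps [m] positive when [v] and [w] vanish. *)
pose m := `|v| + `|w| + 1.
have m0 : 0 < m by rewrite ltr_wpDl ?addr_ge0.
pose h := r / m.
have h0 : 0 < h by rewrite divr_gt0.
have close a b (p q : V) : 0 < a < h -> 0 < b < h -> `|p| + `|q| + 1 = m ->
    `|x - (a *: p + (b *: q + x))| < r.
  move=> /andP[a0 ah] /andP[b0 bh] pqm.
  rewrite !opprD addrCA [x + _]addrCA subrr addr0 -opprD normrN.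
  apply: le_lt_trans (ler_normD _ _) _; rewrite !normrZ !gtr0_norm//.
  have -> : r = h * m by rewrite /h divfK// gt_eqF.
  have := ler_wpM2r (normr_ge0 p) (ltW ah).
  have := ler_wpM2r (normr_ge0 q) (ltW bh).
  rewrite -pqm; nra.
have [c [d [c0h d0h D1]]] := second_difference x h0 dv dwv.
have [c' [d' [c0h' d0h' D2]]] := second_difference x h0 dw dvw.
exists (d *: w + (c *: v + x)), (d' *: v + (c' *: w + x)); split.
- by apply: close => //; rewrite /m [`|w| + _]addrC.
- exact: close.
apply: (mulIf (lt0r_neq0 h0)); apply: (mulIf (lt0r_neq0 h0)).
apply: etrans (esym D1) (etrans _ D2).
by rewrite [h *: w + (_ + _)]addrCA; congr (_ + _); rewrite addrAC.
Qed.

(** * Operators with constant coefficients and reordering of their indices *)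

Lemma class_C_continuous (R : realType) (n k : nat) (u : 'rV[R]_n -> R) :
  class_C k u -> continuous u.
Proof. by case: k => [|k] []. Qed.

Lemma class_C_partial (R : realType) (n k : nat) (u : 'rV[R]_n -> R)
    (i : 'I_n) : class_C k.+1 u -> class_C k (partial i u).
Proof. by case=> _ /(_ i)[]. Qed.

Lemma class_C_derivable (R : realType) (n k : nat) (u : 'rV[R]_n -> R)
    (i : 'I_n) (x : 'rV[R]_n) :
  class_C k.+1 u -> derivable u x (delta_mx 0 i).
Proof. by case=> _ /(_ i)[]. Qed.

Lemma partialC (R : realType) (n k : nat) (u : 'rV[R]_n -> R) (i j : 'I_n) :
  class_C k.+2 u -> partial i (partial j u) = partial j (partial i u).
Proof.
move=> Cu; apply/funext => x.
have Ci := class_C_partial _ Cu.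
apply: (@derive_swap R 'rV[R]_n u (delta_mx 0 j) (delta_mx 0 i)).
- by move=> y; exact: class_C_derivable Cu.
- by move=> y; exact: class_C_derivable Cu.
- by move=> y; exact: class_C_derivable (Ci j).
- by move=> y; exact: class_C_derivable (Ci i).
- exact: (class_C_continuous (class_C_partial i (Ci j))).
- exact: (class_C_continuous (class_C_partial j (Ci i))).
Qed.

Lemma partial_lin_comb (R : realType) (n : nat) (a : 'M[R]_n)
    (g : 'I_n -> 'I_n -> 'rV[R]_n -> R) (i : 'I_n) :
  (forall k l x, derivable (g k l) x (delta_mx 0 i)) ->
  partial i (fun y => \sum_k \sum_l a k l * g k l y) =
  (fun y => \sum_k \sum_l a k l * partial i (g k l) y).
Proof.
move=> dg; apply/funext => x; rewrite {1}/partial.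
have -> : (fun y => \sum_k \sum_l a k l * g k l y) =
    \sum_k \sum_l (a k l *: g k l).
  apply/funext => y; rewrite fct_sumE; apply: eq_bigr => k _.
  by rewrite fct_sumE.
have dag k l : derivable (a k l *: g k l) x (delta_mx 0 i).
  exact: derivableZ.
rewrite derive_sum => [|k]; last exact: derivable_sum.
apply: eq_bigr => k _; rewrite derive_sum//.
by apply: eq_bigr => l _; rewrite deriveZ.
Qed.

Lemma opD2_comp (R : realType) (n : nat) (E A : 'M[R]_n)
    (u : 'rV[R]_n -> R) : class_C 4 u ->
  opD2 E (opD2 A u) = opD4 (fun i j k l => E i j * A k l) u.
Proof.
move=> Cu; apply/funext => x; apply: eq_bigr => i _; apply: eq_bigr => j _.
have Ckl k l : class_C 2 (partial k (partial l u)).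
  by do 2!apply: class_C_partial.
rewrite /opD2 partial_lin_comb => [|k l y]; last exact: class_C_derivable (Ckl k l).
rewrite partial_lin_comb => [|k l y]; last first.
  exact: class_C_derivable (class_C_partial j (Ckl k l)).
rewrite mulr_sumr; apply: eq_bigr => k _; rewrite mulr_sumr.
by apply: eq_bigr => l _; rewrite mulrA.
Qed.

(** This turns the tensor [E i j * A k l] of a composition into [E i k * A j l]. For [E = t 1] the
    former has the quadratic form [t * tr xi * (\sum_k \sum_l A k l * xi k l)], which vanishes on
    trace-free matrices and can be negative; the latter is a sum over rows. *)
Lemma opD4_swap (R : realType) (n : nat) (C : tensor4 R n)
    (u : 'rV[R]_n -> R) : class_C 4 u ->
  opD4 (fun i j k l => C i k j l) u = opD4 C u.
Proof.
move=> Cu; apply/funext => x; apply: eq_bigr => i _.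
rewrite exchange_big; apply: eq_bigr => j _; apply: eq_bigr => k _ /=.
apply: eq_bigr => l _.
by rewrite (partialC j k (class_C_partial l Cu)).
Qed.

Lemma opD4_pair_swap (R : realType) (n : nat) (C : tensor4 R n)
    (u : 'rV[R]_n -> R) : class_C 4 u ->
  opD4 (fun i j k l => C k l i j) u = opD4 C u.
Proof.
move=> Cu; apply/funext => x; rewrite /opD4.
have sumE (G : tensor4 R n) : \sum_i \sum_j \sum_k \sum_l G i j k l =
    \sum_p \sum_q G p.1 p.2 q.1 q.2.
  by rewrite pair_bigA; apply: eq_bigr => p _; rewrite pair_bigA.
rewrite !sumE exchange_big; apply: eq_bigr => -[i j] _; apply: eq_bigr => -[k l] _ /=.
have C1 a := class_C_partial a Cu.
(* Four adjacent transpositions: [l] and [k] move past [i], then past [j]. *)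
rewrite (partialC l i (C1 j)) (partialC k i (class_C_partial l (C1 j))).
by rewrite (partialC l j Cu) (partialC k j (C1 l)).
Qed.

Lemma opD4D (R : realType) (n : nat) (C F : tensor4 R n) (u : 'rV[R]_n -> R)
    (x : 'rV[R]_n) :
  opD4 (fun i j k l => C i j k l + F i j k l) u x = opD4 C u x + opD4 F u x.
Proof.
rewrite /opD4 -big_split; apply: eq_bigr => i _ /=.
rewrite -big_split; apply: eq_bigr => j _ /=.
rewrite -big_split; apply: eq_bigr => k _ /=.
by rewrite -big_split; apply: eq_bigr => l _ /=; rewrite mulrDl.
Qed.

Lemma opD4Z (R : realType) (n : nat) (a : R) (C : tensor4 R n)
    (u : 'rV[R]_n -> R) (x : 'rV[R]_n) :
  opD4 (fun i j k l => a * C i j k l) u x = a * opD4 C u x.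
Proof.
rewrite /opD4; do 4 (rewrite mulr_sumr; apply: eq_bigr => ? _).
by rewrite mulrA.
Qed.

(** * Quadratic forms and lower bounds *)

Definition qform (R : realType) (n : nat) (A : 'M[R]_n) (eta : 'rV[R]_n) : R :=
  \sum_i \sum_j A i j * eta 0 i * eta 0 j.

Lemma qformE (R : realType) (n : nat) (A : 'M[R]_n) (eta : 'rV[R]_n) :
  qform A eta = (eta *m A *m eta^T) 0 0.
Proof.
rewrite mxE [RHS](eq_bigr (fun j => \sum_i A i j * eta 0 i * eta 0 j)).
  by rewrite /qform exchange_big.
move=> j _; rewrite !mxE mulr_suml; apply: eq_bigr => i _.
by rewrite [A i j * _]mulrC.
Qed.

Lemma qform_ge0 (R : realType) (n : nat) (A : 'M[R]_n) (eta : 'rV[R]_n) :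
  pos_def2 A -> 0 <= qform A eta.
Proof.
move=> posA; have [->|eta0] := eqVneq eta 0; last exact/ltW/posA.
by rewrite qformE trmx0 mulmx0 mxE.
Qed.

Lemma pos_def2_unitmx (R : realType) (n : nat) (A : 'M[R]_n) :
  pos_def2 A -> A \in unitmx.
Proof.
move=> posA; rewrite -row_free_unit -kermx_eq0; apply/rowV0P => eta.
move=> /sub_kermxP etaA; apply/eqP; apply: contraT => /posA.
by rewrite -/(qform A eta) qformE etaA mul0mx mxE ltxx.
Qed.

(* Cauchy-Schwarz for the inner product [A]: the [i]-th coordinate is the inner
   product with the [i]-th row of the inverse of [A]. *)
Lemma coord_qform_bound (R : realType) (n : nat) (A : 'M[R]_n)
    (eta : 'rV[R]_n) (i : 'I_n) : symmetric2 A -> pos_def2 A ->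
  eta 0 i ^+ 2 <= qform A (row i (invmx A)) * qform A eta.
Proof.
move=> symA posA; have uA := pos_def2_unitmx posA.
have trA : A^T = A by apply/matrixP => k l; rewrite mxE symA.
set w := row i (invmx A).
have wA : w *m A = delta_mx 0 i by rewrite -row_mul mulVmx// row1.
have w0 : w != 0.
  apply/eqP => w0; have /matrixP/(_ 0 i) := wA.
  by rewrite w0 mul0mx !mxE !eqxx => /eqP; rewrite eq_sym oner_eq0.
have qw0 : 0 < qform A w := posA _ w0.
(* This [s] minimizes [qform A (eta - s *: w)]; the minimum times [qform A w] is
   [qform A w * qform A eta - eta 0 i ^+ 2]. *)
pose s := eta 0 i / qform A w.
have wAeta : w *m A *m eta^T = (eta 0 i)%:M.
  by rewrite wA -rowE [LHS]mx11_scalar !mxE.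
have etaAw : eta *m A *m w^T = (eta 0 i)%:M.
  by rewrite -{1}[eta]trmxK -{1}trA -!trmx_mul mulmxA wAeta tr_scalar_mx.
have : 0 <= qform A (eta - s *: w) by exact: qform_ge0.
have trB : (eta - s *: w)^T = eta^T - s *: w^T by rewrite linearB linearZ.
rewrite qformE trB !mulmxBl !mulmxBr -!scalemxAl -!scalemxAr.
have qE z : z *m A *m z^T = (qform A z)%:M by rewrite qformE -mx11_scalar.
rewrite !qE wAeta etaAw !mxE eqxx !mulr1n.
have sE : s * qform A w = eta 0 i by rewrite /s divfK// gt_eqF.
move=> /(mulr_ge0 (ltW qw0)); rewrite sE subrr subr0 mulrBr mulrA.
by rewrite [qform A w * s]mulrC sE subr_ge0.
Qed.

Lemma symmetrization_opD4 (R : realType) (n : nat) (C : tensor4 R n)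
    (u : 'rV[R]_n -> R) (x : 'rV[R]_n) : class_C 4 u ->
  opD4 (fun i j k l => 2^-1 * (C i j k l + C k l i j)) u x = opD4 C u x.
Proof.
move=> Cu; rewrite opD4Z opD4D opD4_pair_swap//.
by field.
Qed.

Lemma sum_row_qform (R : realType) (n : nat) (A xi : 'M[R]_n) (t : R) :
  \sum_i \sum_j \sum_k \sum_l
    (t *: 1%:M : 'M[R]_n) i k * A j l * xi i j * xi k l =
  t * \sum_i qform A (row i xi).
Proof.
rewrite mulr_sumr; apply: eq_bigr => i _; rewrite mulr_sumr.
apply: eq_bigr => j _; rewrite (bigD1 i)//= [X in _ + X]big1 ?addr0 => [|k ki].
  by rewrite mulr_sumr; apply: eq_bigr => l _; rewrite !mxE eqxx mulr1 !mulrA.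
by apply: big1 => l _; rewrite !mxE eq_sym (negbTE ki) mulr0 !mul0r.
Qed.

(** Each product [xi i j * xi k l] has absolute value at most [b], since twice it is bounded by the
    sum of the two squares. *)
Lemma tensor_form_bound (R : realType) (n : nat) (C : tensor4 R n)
    (xi : 'M[R]_n) (b : R) : (forall i j, xi i j ^+ 2 <= b) ->
  - ((\sum_i \sum_j \sum_k \sum_l `|C i j k l|) * b) <=
  \sum_i \sum_j \sum_k \sum_l C i j k l * xi i j * xi k l.
Proof.
move=> xib; rewrite mulr_suml -sumrN; apply: ler_sum => i _.
rewrite mulr_suml -sumrN; apply: ler_sum => j _.
rewrite mulr_suml -sumrN; apply: ler_sum => k _.
rewrite mulr_suml -sumrN; apply: ler_sum => l _.
rewrite -mulrA lerNl -mulrN.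
apply: le_trans (ler_norm _) _; rewrite normrM ler_wpM2l// normrN ler_norml.
have xij := xib i j; have xkl := xib k l.
by apply/andP; split; nra.
Qed.

Unset Implicit Arguments.

Theorem lemma2p5 (R : realType) (n : nat) (n_gt0 : (0 < n)%N)
    (A : 'M[R]_n) (symA : symmetric2 A) (posA : pos_def2 A)
    (C : tensor4 R n) :
  exists (E : 'M[R]_n) (F : tensor4 R n),
    [/\ symmetric2 E, pos_semidef2 E, symmetric4 F, pos_semidef4 F &
      forall u : 'rV[R]_n -> R, class_C 4 u ->
        forall x : 'rV[R]_n,
          - opD4 C u x = opD2 E (opD2 A u) x - opD4 F u x].
Proof.
pose S : tensor4 R n := fun i j k l => 2^-1 * (C i j k l + C k l i j).
pose M := \sum_i \sum_j \sum_k \sum_l `|S i j k l|.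
have M0 : 0 <= M by do 4 apply: sumr_ge0 => ? _.
(* The summands are the diagonal entries of the inverse of [A], so [K] is its trace. It dominates
   the constants of [coord_qform_bound] for all coordinates at once. *)
pose K := \sum_i qform A (row i (invmx A)).
have K0 : 0 <= K by apply: sumr_ge0 => i _; exact: qform_ge0.
(* The factor [K] converts row values of [A] into a bound on squared entries, and [M] is the cost of
   the form of [S] per unit of that bound. *)
pose E : 'M[R]_n := (M * K) *: 1%:M.
exists E, (fun i j k l => E i k * A j l + S i j k l); split.
- by move=> i j; rewrite !mxE eq_sym.
- move=> eta; apply: sumr_ge0 => i _; apply: sumr_ge0 => j _; rewrite !mxE.
  have [<-|_] := eqVneq i j; last by rewrite mulr0 !mul0r.
  rewrite mulr1 -[_ * _ * _]mulrA -expr2.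
  by rewrite mulr_ge0 ?sqr_ge0// mulr_ge0.
- by move=> i j k l; rewrite !mxE eq_sym (symA j l) /S [C i j k l + _]addrC.
- move=> xi.
  have -> : \sum_i \sum_j \sum_k \sum_l
      (E i k * A j l + S i j k l) * xi i j * xi k l =
      \sum_i \sum_j \sum_k \sum_l E i k * A j l * xi i j * xi k l +
      \sum_i \sum_j \sum_k \sum_l S i j k l * xi i j * xi k l.
    do 4 (rewrite -big_split; apply: eq_bigr => ? _ /=).
    by rewrite !mulrDl.
  (* What remains is [tensor_form_bound] with [b = K * \sum_i qform A (row i xi)]. Each squared
     entry of [xi] is at most one summand of [K] times one row value, and all of these are
     nonnegative. *)
  rewrite sum_row_qform -mulrA -lerBlDl sub0r.
  apply: tensor_form_bound => i j.
  have -> : xi i j = row i xi 0 j by rewrite mxE.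
  apply: le_trans (coord_qform_bound _ _ symA posA) _.
  apply: ler_pM; try exact: qform_ge0.
    by rewrite /K (bigD1 j)//= lerDl sumr_ge0// => k _; exact: qform_ge0.
  by rewrite (bigD1 i)//= lerDl sumr_ge0// => k _; exact: qform_ge0.
- move=> u Cu x.
  (* The rearranged composition is the first summand of [F], so it cancels and leaves the operator
     of [S], which is that of [C]. *)
  rewrite opD2_comp// opD4D (symmetrization_opD4 C x Cu).
  by rewrite (@opD4_swap _ _ (fun i j k l => E i j * A k l) u Cu); ring.
Qed.
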